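(* Let $P(x)=R(x)-q$ be a real polynomial in $x$ of degree $n\ge 2$, with $R(0)=0$ and $q\in\mathbb{R}$. Set $D(q)=\operatorname{dis}_x(P(x))$, regarded as a polynomial in $q$. Then $$D(R(x))=(R'(x))^2\,U(x)=(P'(x))^2\,U(x)$$ for some polynomial $U$ of degree $(n-1)(n-2)$. Moreover, if all the roots of $R$ are simple, then $U(0)\neq 0$.
   Context: $R\in\mathbb{R}[x]$ is a polynomial of degree $n$ not depending on $q$, and $P'$ is the derivative of $P$ with respect to $x$ (so $P'=R'$). $\operatorname{dis}_x(P(x))$ denotes the usual discriminant of $P$ as a polynomial of degree $n$ in $x$; its coefficients being polynomials in $q$, it is a polynomial $D(q)$ in $q$. ''All the roots of $R$'' refers to all roots of $R$ in $\mathbb{C}$. *)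

(* Defs.v *)
From mathcomp Require Import all_boot all_order all_algebra.
From mathcomp Require Import complex reals.
Set Implicit Arguments.
Unset Strict Implicit.
Unset Printing Implicit Defensive.
Import GRing.Theory Num.Theory.
Local Open Scope ring_scope.

(* For p of degree n with leading coefficient a,
   dis(p) = (-1)^(n(n-1)/2) a^(-1) Res(p, p').
   The inverse is that of the coefficient ring, so this is meaningful only when
   a is a unit. MathComp's Sylvester matrix lists coefficients in increasing
   degree, which turns Res(p, q) into (-1)^(deg p * deg q) Res(p, q); the sign
   is trivial for q = p' of degree n - 1. *)
Definition discriminant (A : comUnitRingType) (p : {poly A}) : A :=
  (-1) ^+ 'C((size p).-1, 2) * (lead_coef p)^-1 * resultant p p^`().

(* The polynomial f(x) - q in the variable x with coefficients in F[q]: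
   the outer indeterminate is x, the inner one is q. *)
Definition poly_subq (F : comNzRingType) (f : {poly F}) : {poly {poly F}} :=
  f^:P - ('X)%:P.

Definition discr_subq (F : fieldType) (f : {poly F}) : {poly F} :=
  discriminant (poly_subq f).

(* Simplicity of the roots in R[i], not only of the real ones. *)
Definition complex_roots_simple (R : rcfType) (f : {poly R}) : Prop :=
  let fC := map_poly (real_complex R) f in
  forall z : R[i], root fC z -> mup z fC = 1%N.

(* Main.v *)
(* The resultant obeys Res(f, (X - c) g) = f(c) Res(f, g): replacing the rows
   X^(i+1) f of the Sylvester matrix by (X - c) X^i f leaves f as the only row
   not vanishing at c. Over C, writing R' = a prod_j (x - c_j), this makes D(q)
   a nonzero multiple of prod_j (q - R(c_j)). Each factor R(x) - R(c_j) of
   D(R(x)) has a double zero at c_j, so R'^2 divides D(R(x)), over C and hence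
   over the reals. The degree of U is then a count, and U(0) != 0 because
   D(0) = R'(0)^2 U(0) vanishes only if some c_j is a multiple root of R. *)
Require Import Defs.
From mathcomp Require Import all_boot all_order all_algebra.
From mathcomp Require Import complex reals.
Set Implicit Arguments.
Unset Strict Implicit.
Unset Printing Implicit Defensive.
Import GRing.Theory Num.Theory.
Local Open Scope ring_scope.

Section ResultantProduct.

Variable R : comNzRingType.
Implicit Types (f g : {poly R}) (c : R) (F G : nat -> {poly R}).

Definition coef_mx N F : 'M[R]_N := \matrix_(i < N, j < N) (F i)`_j.

Lemma det_trig1 N (A : 'M[R]_N) :
  is_trig_mx A -> (forall i, A i i = 1) -> \det A = 1.
Proof. by move=> /det_trig -> A1; rewrite big1. Qed.

(** Right multiplication by the unitriangular [V], whose first column lists the powers of [c], turns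
    column 0 into the values of the rows at [c]. All of these vanish except the first, so expanding
    along column 0 leaves a single minor. *)
Lemma det_coef_mx_XsubC N c F G :
    (size (F 0%N) <= N.+1)%N -> (forall i, (i < N)%N -> size (G i) <= N)%N ->
    (forall i, (i < N)%N -> F i.+1 = ('X - c%:P) * G i) ->
  \det (coef_mx N.+1 F) = (F 0%N).[c] * \det (coef_mx N G).
Proof.
move=> F0 sG FG.
have sF (i : 'I_N.+1) : (size (F i) <= N.+1)%N.
  case: i => -[|i] //= ltiN; rewrite FG //.
  apply: leq_trans (size_polyMleq _ _) _; rewrite size_XsubC /=.
  by rewrite ltnS sG.
pose V := \matrix_(i < N.+1, j < N.+1)
  if j == 0 then c ^+ i else (i == j)%:R : R.
have V1 : \det V = 1.
  apply: det_trig1 => [|i]; last by rewrite mxE eqxx; case: eqP => // ->.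
  apply/is_trig_mxP => i j ltij; rewrite mxE -!val_eqE /= (ltn_eqF ltij).
  by rewrite gtn_eqF // (leq_ltn_trans _ ltij).
(* [W] is multiplication by ['X - c%:P] with the constant coefficient dropped: column [j] gives
   coefficient [j.+1] of the product. The surviving minor is the matrix of [G] times [W]. *)
pose W := \matrix_(i < N, j < N) ((i == j)%:R - c *+ (i == j.+1 :> nat)).
have W1 : \det W = 1.
  apply: det_trig1 => [|i]; last first.
    by rewrite mxE eqxx ltn_eqF // subr0.
  apply/is_trig_mxP => i j ltij; rewrite mxE -!val_eqE /= (ltn_eqF ltij).
  by rewrite ltn_eqF ?subr0 // (ltn_trans ltij).
have FV0 i : (coef_mx N.+1 F *m V) i 0 = (F i).[c].
  rewrite (horner_coef_wide _ (sF i)) mxE.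
  by apply: eq_bigr => k _; rewrite !mxE.
have FVS i j : (coef_mx N.+1 F *m V) i (lift 0 j) = (F i)`_j.+1.
  rewrite mxE (bigD1 (lift 0 j)) //= !mxE eqxx mulr1 big1 ?addr0 // => k.
  by rewrite !mxE => /negPf ->; rewrite mulr0.
rewrite -[LHS]mulr1 -V1 -det_mulmx (expand_det_col _ 0) big_ord_recl FV0.
rewrite big1 ?addr0 => [|i _]; last first.
  by rewrite FV0 /= FG // hornerM hornerXsubC subrr !mul0r.
rewrite /cofactor expr0 mul1r -[in RHS](mulr1 (\det _)) -W1 -det_mulmx.
congr (_ * \det _); apply/matrixP=> i j.
rewrite [LHS]mxE [LHS]mxE FVS FG // mulrBl coefB coefXM coefCM /= [RHS]mxE.
under [RHS]eq_bigr => k _ do rewrite !mxE mulrBr.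
rewrite sumrB (bigD1 j) //= eqxx mulr1 big1 ?addr0 => [|k /negPf]; last first.
  by move=> ->; rewrite mulr0.
congr (_ - _).
transitivity (\sum_(k < N | k == j.+1 :> nat) (G i)`_k * c); last first.
  by rewrite big_mkcond; apply: eq_bigr => k _; case: ifP; rewrite ?mulr0.
rewrite (big_ord1_eq _ (fun k => (G i)`_k * c)).
(* In the last column the index [j.+1] falls outside the matrix; the missing term is a coefficient
   of [G i] beyond its size bound, hence 0. *)
case: ltnP => [_|leNj]; first by rewrite mulrC.
by rewrite nth_default ?mulr0 // (leq_trans (sG _ _)).
Qed.

(** The number [k] of shifts of [f] is a parameter rather than read off [size g], which lets an
    induction on the factors of [g] change it one step at a time. *)
Definition sylvester_row k f g i : {poly R} :=
  if (i < k)%N then 'X^i * f else 'X^(i - k) * g.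

Lemma resultantE f g :
  resultant f g =
  \det (coef_mx ((size g).-1 + (size f).-1) (sylvester_row (size g).-1 f g)).
Proof.
congr (\det _); apply/matrixP=> i j; rewrite Sylvester_mxE mxE /sylvester_row.
case: splitP => k ->.
  by rewrite coefXnM ltnNge mulrb; case: leqP.
by rewrite addKn coefXnM ltnNge mulrb; case: leqP.
Qed.

Lemma det_sylvester_XsubC k m f g c :
    (size f <= m.+1)%N -> (size g <= k.+1)%N ->
  \det (coef_mx (k.+1 + m) (sylvester_row k.+1 f (('X - c%:P) * g))) =
  f.[c] * \det (coef_mx (k + m) (sylvester_row k f g)).
Proof.
move=> sf sg; pose H := sylvester_row k.+1 f (('X - c%:P) * g).
(* These are the rows after the row operations: below [f] stands the smaller Sylvester matrix, each
   row multiplied by ['X - c%:P]. *)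
pose F i := if i is i'.+1 then ('X - c%:P) * sylvester_row k f g i' else f.
have <- : (F 0%N).[c] = f.[c] by [].
rewrite -(@det_coef_mx_XsubC _ _ F) //; last 2 first.
- by rewrite (leq_trans sf) // ltnS leq_addl.
- move=> i ltim; rewrite /sylvester_row; case: ltnP => [ltik|leki].
    rewrite (leq_trans (size_polyMleq _ _)) // size_polyXn addSn /=.
    by rewrite (leq_trans (leq_add (leqnn i) sf)) // addnS -addSn leq_add2r.
  rewrite (leq_trans (size_polyMleq _ _)) // size_polyXn addSn /=.
  by rewrite (leq_trans (leq_add (leqnn _) sg)) // addnS subnK.
(* [L] subtracts [c] times the preceding row. The condition [i <= k] confines this to the shifts of
   [f]; the later rows already contain the factor ['X - c%:P]. *)
pose L := \matrix_(i < (k + m).+1, j < (k + m).+1)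
   ((i == j)%:R - c *+ ((i == j.+1 :> nat) && (i <= k)%N)).
have L1 : \det L = 1.
  apply: det_trig1 => [|i]; last first.
    by rewrite mxE eqxx ltn_eqF // subr0.
  apply/is_trig_mxP => i j ltij; rewrite mxE -!val_eqE /= (ltn_eqF ltij).
  by rewrite ltn_eqF ?subr0 // (ltn_trans ltij).
rewrite -[LHS]mul1r -L1 -det_mulmx; congr (\det _); apply/matrixP=> i j.
rewrite [LHS]mxE; under [LHS]eq_bigr => l _ do rewrite !mxE mulrBl.
rewrite sumrB (bigD1 i) //= eqxx mul1r big1 ?addr0 => [|l]; last first.
  by rewrite eq_sym => /negPf ->; rewrite mul0r.
rewrite [RHS]mxE -/H.
case: i => -[|i] ltim /=.
  rewrite big1 ?subr0 /F /H /sylvester_row /= ?expr0 ?mul1r // => l _.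
  by rewrite mulr0n mul0r.
transitivity ((H i.+1)`_j - (c *+ (i < k)%N) * (H i)`_j).
  congr (_ - _).
  transitivity (\sum_(l < (k + m).+1 | l == i :> nat)
                  (c *+ (i < k)%N) * (H l)`_j).
    rewrite [RHS]big_mkcond; apply: eq_bigr => l _.
    by rewrite eqSS eq_sym; case: eqP; rewrite ?mulr0n ?mul0r.
  rewrite (big_ord1_eq _ (fun l => (c *+ (i < k)%N) * (H l)`_j)).
  by rewrite ltnS ltnW.
rewrite /H /F /sylvester_row !ltnS; case: ltnP => [ltik|leki].
  by rewrite (ltnW ltik) mulr1n -coefCM -coefB exprS mulrBl !mulrA.
by rewrite mulr0n mul0r subr0 subSS mulrCA.
Qed.

(** Induction peels off one linear factor at a time. The coefficients lie in an arbitrary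
    commutative ring because the formula is later applied over polynomials in q. *)
Lemma resultant_prod_XsubC f a (s : seq R) : a != 0 ->
  resultant f (a *: \prod_(c <- s) ('X - c%:P)) =
  a ^+ (size f).-1 * \prod_(c <- s) f.[c].
Proof.
move=> a0; have szs (t : seq R) :
    size (a *: \prod_(c <- t) ('X - c%:P)) = (size t).+1.
  by rewrite -mul_polyC size_Mmonic ?polyC_eq0 // ?monic_prod_XsubC //
             size_polyC a0 size_prod_XsubC.
rewrite resultantE szs /=; elim: s => [|c s IHs].
  (* With no factor left only the rows ['X^i * a%:P] remain: a scalar matrix of order
     [(size f).-1]. *)
  rewrite !big_nil mulr1 alg_polyC -det_scalar; congr (\det _).
  apply/matrixP=> i j; rewrite !mxE /sylvester_row /= subn0 coefMC coefXn.
  by rewrite eq_sym mulr_natl.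
rewrite !big_cons scalerAr det_sylvester_XsubC ?szs ?leqSpred // IHs.
by rewrite mulrCA.
Qed.

End ResultantProduct.

Lemma size_poly_subq (F : fieldType) (f : {poly F}) :
  (1 < size f)%N -> size (poly_subq f) = size f.
Proof.
move=> f1; rewrite size_polyDl size_map_polyC // size_polyN.
exact: leq_ltn_trans (size_polyC_leq1 _) f1.
Qed.

Lemma lead_coef_poly_subq (F : fieldType) (f : {poly F}) :
  (1 < size f)%N -> lead_coef (poly_subq f) = (lead_coef f)%:P.
Proof.
move=> f1; rewrite lead_coefDl ?lead_coef_map_inj //; first exact: polyC_inj.
by rewrite size_map_polyC size_polyN (leq_ltn_trans (size_polyC_leq1 _)).
Qed.

Lemma deriv_poly_subq (F : fieldType) (f : {poly F}) :
  (poly_subq f)^`() = f^`()^:P.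
Proof. by rewrite derivB derivC subr0 deriv_map. Qed.

(** Subtracting q affects only the constant coefficient, so the leading coefficient is a nonzero
    constant, a unit among the polynomials in q, and the inverse in [discriminant] is a genuine
    one. *)
Lemma discr_subqE (F : fieldType) (f : {poly F}) : (1 < size f)%N ->
  discr_subq f = ((-1) ^+ 'C((size f).-1, 2) * (lead_coef f)^-1) *:
                 resultant (poly_subq f) f^`()^:P.
Proof.
move=> f1; have f0 : lead_coef f != 0.
  by rewrite lead_coef_eq0 -size_poly_gt0 ltnW.
rewrite /discr_subq /discriminant size_poly_subq // lead_coef_poly_subq //.
rewrite deriv_poly_subq -mul_polyC polyCM; congr (_ * _ * _).
  by rewrite rmorph_sign.
by rewrite -rmorphV ?unitfE.
Qed.

(** A field embedding preserves degrees, hence the shape of the Sylvester matrix. This carries D to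
    the complex numbers, where the derivative splits. *)
Lemma map_discr_subq (F L : fieldType) (iota : {rmorphism F -> L})
    (f : {poly F}) : (1 < size f)%N -> f^`() != 0 ->
  map_poly iota (discr_subq f) = discr_subq (map_poly iota f).
Proof.
move=> f1 df0; rewrite !discr_subqE ?size_map_poly // lead_coef_map.
rewrite map_polyZ rmorphM rmorph_sign fmorphV; congr (_ *: _).
have f0 : f != 0 by rewrite -size_poly_gt0 ltnW.
rewrite map_resultant ?map_poly_eq0 ?lead_coef_poly_subq //; first last.
- by rewrite lead_coef_eq0 map_polyC_eq0.
- by rewrite polyC_eq0 lead_coef_eq0.
have mapP (g : {poly F}) : map_poly (map_poly iota) g^:P = (map_poly iota g)^:P.
  by rewrite -!map_poly_comp; apply: eq_map_poly => x /=; rewrite map_polyC.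
by rewrite mapP deriv_map rmorphB /= mapP map_polyC /= map_polyX.
Qed.

Lemma discr_subq_prod (F : fieldType) (f : {poly F}) (s : seq F) :
    (1 < size f)%N -> f^`() != 0 ->
    f^`() = lead_coef f^`() *: \prod_(c <- s) ('X - c%:P) ->
  exists2 b, b != 0 & discr_subq f = b *: \prod_(c <- s) ('X - f.[c]%:P).
Proof.
move=> f1; rewrite -lead_coef_eq0; set a := lead_coef f^`() => a0 dfE.
have f0 : lead_coef f != 0 by rewrite lead_coef_eq0 -size_poly_gt0 ltnW.
pose e : F := (-1) ^+ 'C((size f).-1, 2) * (lead_coef f)^-1.
(* [e] normalizes the discriminant, the power of [a] comes from the resultant, and the sign turns
   each factor f(c) - q into q - f(c). *)
exists (e * (a ^+ (size f).-1 * (-1) ^+ size s)).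
  by rewrite !mulf_neq0 ?signr_eq0 ?invr_eq0 ?expf_neq0.
have dfPE : f^`()^:P = a%:P *: \prod_(d <- map polyC s) ('X - d%:P).
  by rewrite dfE map_polyZ big_map map_prod_XsubC.
rewrite discr_subqE // -[RHS]scalerA; congr (_ *: _); rewrite {}dfPE.
rewrite resultant_prod_XsubC ?polyC_eq0 // big_map size_poly_subq //.
rewrite -mul_polyC polyCM !rmorphXn /= polyCN -mulrA; congr (_ * _).
elim: {dfE} s => [|c s IHs]; first by rewrite !big_nil expr0 mulr1.
rewrite !big_cons {}IHs exprS /poly_subq hornerD hornerN hornerC horner_map /=.
by rewrite mulrACA mulN1r opprB.
Qed.

Lemma double_root_dvdp (F : fieldType) (f : {poly F}) (c : F) :
  root f c -> root f^`() c -> ('X - c%:P) ^+ 2 %| f.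
Proof.
case/factor_theorem=> g ->; rewrite derivM derivXsubC mulr1 /root hornerD.
rewrite hornerM hornerXsubC subrr mulr0 add0r => g0.
by rewrite expr2 dvdp_mul // -root_factor_theorem.
Qed.

(** Since [s] lists roots with multiplicity, divisibility is proved factor by factor along [s], and
    repeated critical points need no separate treatment. *)
Lemma deriv_sqr_dvdp_discr_subq (F : fieldType) (f : {poly F}) (s : seq F) :
    (1 < size f)%N -> f^`() != 0 ->
    f^`() = lead_coef f^`() *: \prod_(c <- s) ('X - c%:P) ->
  f^`() ^+ 2 %| discr_subq f \Po f.
Proof.
move=> f1 df0 dfE; have [b b0 ->] := discr_subq_prod f1 df0 dfE.
rewrite linearZ /= dvdpZr // rmorph_prod /=.
have ds c : c \in s -> root f^`() c.
  by move=> cs; rewrite dfE rootZ ?lead_coef_eq0 // root_prod_XsubC.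
rewrite [in _ ^+ 2]dfE exprZn dvdpZl ?expf_neq0 ?lead_coef_eq0 // {df0 dfE}.
elim: s ds => [|c s IHs] ds; first by rewrite !big_nil expr1n.
rewrite !big_cons exprMn dvdp_mul ?IHs //.
  rewrite double_root_dvdp // comp_polyB comp_polyX comp_polyC.
    by rewrite /root !hornerE subrr.
  by rewrite derivB derivC subr0 ds ?mem_head.
by move=> d sd; rewrite ds // in_cons sd orbT.
Qed.

Theorem proposition1p1 (K : realType) (n : nat) (R : {poly K})
    (hn : (2 <= n)%N) (hdeg : size R = n.+1) (hR0 : R.[0] = 0) :
  let D : {poly K} := discr_subq R in
  exists U : {poly K},
    [/\ D \Po R = R^`() ^+ 2 * U,
        forall q : K, let P := R - q%:P in D \Po R = P^`() ^+ 2 * U,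
        size U = ((n - 1) * (n - 2)).+1
      & complex_roots_simple R -> U.[0] != 0].
Proof.
move=> D; pose iota := real_complex K; pose RC := map_poly iota R.
have R1 : (1 < size R)%N by rewrite hdeg ltnS ltnW.
have szdR : size R^`() = n by rewrite polyorder.size_deriv hdeg.
have dR0 : R^`() != 0 by rewrite -size_poly_gt0 szdR ltnW.
have DE : map_poly iota D = discr_subq RC by rewrite map_discr_subq.
have RC1 : (1 < size RC)%N by rewrite size_map_poly.
have dRCE : RC^`() = map_poly iota R^`() by rewrite deriv_map.
have dRC0 : RC^`() != 0 by rewrite dRCE map_poly_eq0.
have [s sE] := closed_field_poly_normal RC^`().
have [b b0 DCE] := discr_subq_prod RC1 dRC0 sE.
have szs : (size s).+1 = n.
  rewrite -szdR -(size_map_poly iota) -dRCE sE size_scale ?lead_coef_eq0 //.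
  by rewrite size_prod_XsubC.
have szD : size D = n.
  by rewrite -(size_map_poly iota) DE DCE size_scale // size_prod_XsubC.
(* Divisibility is insensitive to field extension: it is checked over the complex numbers, yet the
   quotient [U] is real. *)
have /dvdpP[U UE] : R^`() ^+ 2 %| D \Po R.
  rewrite -(dvdp_map iota) map_comp_poly rmorphXn /= -dRCE DE.
  exact: deriv_sqr_dvdp_discr_subq sE.
rewrite mulrC in UE; exists U; split => //.
- by move=> q P; rewrite derivB derivC subr0.
- have DR0 : D \Po R != 0 by rewrite comp_poly_eq0 // -size_poly_gt0 szD ltnW.
  have U0 : U != 0 by apply: contraNneq DR0 => U0; rewrite UE U0 mulr0.
  (* Comparing degrees, (n-1)n = 2(n-1) + deg U. *)
  have := size_comp_poly D R; rewrite szD hdeg UE size_mul ?expf_neq0 //.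
  rewrite expr2 size_mul // szdR (polySpred U0) -szs !addnS !addSn /=.
  rewrite mulnS -addnA => /addnI /(canRL (addKn _)) ->.
  by rewrite !subSS subn0 mulnBr muln1.
- move=> simpleR; have RD : D.[0] = R^`().[0] ^+ 2 * U.[0].
    by rewrite -horner_exp -hornerM -UE horner_comp hR0.
  suff: D.[0] != 0 by rewrite RD mulf_eq0 negb_or => /andP[].
  (* Over the complex numbers D(0) is [b] times the product of the -R(c). A zero factor would make
     [c] a common root of R and R', so of multiplicity at least 2 in R. *)
  rewrite -(fmorph_eq0 iota) -horner_map rmorph0 DE DCE hornerZ mulf_neq0 //.
  rewrite horner_prod prodf_seq_neq0; apply/allP => c sc /=.
  rewrite hornerXsubC sub0r oppr_eq0; apply/negP => RCc.
  have dRCc : root RC^`() c by rewrite sE rootZ ?lead_coef_eq0 // root_prod_XsubC.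
  have RC0 : RC != 0 by rewrite -size_poly_gt0 ltnW.
  have := mup_geq c 2 RC0.
  by rewrite (simpleR c RCc) double_root_dvdp.
Qed.
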